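(* Let $L$ be a left Leibniz algebra (of arbitrary, possibly infinite, dimension) over a field $F$, and let $D$ be a subalgebra of $\mathrm{Der}(L)$ such that $\mathrm{Ad}^{l}(L)\leqslant D$. Suppose that $\dim_{F}(D/\mathrm{Ad}^{l}(L))=k$ is finite. If $\dim_{F}(L/\mathrm{A}_{L}(D))=t$ is finite, then $[L,D]$ is finite-dimensional and $\dim_{F}([L,D])\leqslant t(k+t)$.
   Context: A left Leibniz algebra over a field $F$ is an $F$-vector space $L$ with a bilinear operation $[\,,\,]$ satisfying $[[x,y],z]=[x,[y,z]]-[y,[x,z]]$ for all $x,y,z\in L$. A derivation of $L$ is an $F$-linear map $\alpha:L\to L$ with $\alpha([x,y])=[\alpha(x),y]+[x,\alpha(y)]$ for all $x,y\in L$. $\mathrm{Der}(L)$ is the Lie algebra of all derivations of $L$ under the commutator bracket. For $a\in L$ let $\mathrm{l}_{a}:L\to L$, $\mathrm{l}_{a}(x)=[a,x]$; each $\mathrm{l}_{a}$ is a derivation, and $\mathrm{Ad}^{l}(L)=\{\mathrm{l}_{a}\mid a\in L\}$ is an ideal of $\mathrm{Der}(L)$. The symbol $\leqslant$ between algebras means ''is contained in as a subalgebra''. The left center of $L$ is $\zeta^{l}(L)=\{x\in L\mid [x,y]=0\text{ for each }y\in L\}$. For a subalgebra $D$ of $\mathrm{Der}(L)$ with $\mathrm{Ad}^{l}(L)\leqslant D$: - $\mathrm{Ann}_{L}(D)=\bigcap_{\alpha\in D}\mathrm{Ker}(\alpha)$; - the $D$-center of $L$ is $\mathrm{A}_{L}(D)=\mathrm{Ann}_{L}(D)\cap\zeta^{l}(L)$,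 which is an ideal of $L$; - the $D$-derived subalgebra of $L$ is $[L,D]=\sum_{\alpha\in D}\mathrm{Im}(\alpha)$ (sum of subspaces). *)

(* Defs.v *)
From HB Require Import structures.
From mathcomp Require Import all_boot all_order all_algebra.
From mathcomp Require Import boolp classical_sets functions.

Set Implicit Arguments.
Unset Strict Implicit.
Unset Printing Implicit Defensive.

Import GRing.Theory.
Local Open Scope classical_set_scope.
Local Open Scope ring_scope.

HB.mixin Record isLeftLeibniz (F : fieldType) L of GRing.Lmodule F L := {
  lbr : L -> L -> L;
  lbr_linearl : forall y, linear (fun x => lbr x y);
  lbr_linearr : forall x, linear (lbr x);
  lbr_leibniz : forall x y z,
    lbr (lbr x y) z = lbr x (lbr y z) - lbr y (lbr x z)
}.

#[short(type="leibnizType")]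
HB.structure Definition LeftLeibniz (F : fieldType) :=
  {L of isLeftLeibniz F L & GRing.Lmodule F L}.

Section Subspaces.
Variables (F : fieldType) (V : lmodType F).

Definition subspace (W : set V) : Prop :=
  W 0 /\ forall (a : F) (u v : V), W u -> W v -> W (a *: u + v).

(* For subspaces W `<=` U of V: the cosets e i + W form a basis of U / W.
   No finiteness of dimension is assumed of V, U or W. *)
Definition basis_mod (U W : set V) (n : nat) (e : 'I_n -> V) : Prop :=
  [/\ forall i, U (e i),
      forall c : 'I_n -> F, W (\sum_i c i *: e i) -> forall i, c i = 0
    & forall u, U u -> exists c : 'I_n -> F, W (u - \sum_i c i *: e i)].

(* dim (U / W) is finite and equal to n. *)
Definition quot_has_dim (U W : set V) (n : nat) : Prop :=
  exists e : 'I_n -> V, basis_mod U W e.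

Definition has_dim (U : set V) (n : nat) : Prop := quot_has_dim U [set 0] n.

End Subspaces.

Section LeftLeibnizAlgebras.
Variables (F : fieldType) (L : leibnizType F).

(* Linear maps are bare functions satisfying [linear], so that they live in
   the vector space L -> L with pointwise operations. *)
Definition Der : set (L -> L) :=
  [set f | linear f /\ forall x y, f (lbr x y) = lbr (f x) y + lbr x (f y)].

Definition Der_subalgebra (D : set (L -> L)) : Prop :=
  [/\ D `<=` Der, subspace D
    & forall f g, D f -> D g -> D ((f \o g) - (g \o f))].

Definition Adl : set (L -> L) := range (fun a : L => lbr a).

Definition left_center : set L := [set x | forall y, lbr x y = 0].

Definition Ann (D : set (L -> L)) : set L :=
  \bigcap_(f in D) (f @^-1` [set 0]).

Definition Dcenter (D : set (L -> L)) : set L := Ann D `&` left_center.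

(* The sum of the subspaces Im f, f in D: all finite sums of elements of
   these images. *)
Definition Dderived (D : set (L -> L)) : set L :=
  [set x | exists n (f : 'I_n -> L -> L) (y : 'I_n -> L),
     (forall i, D (f i)) /\ x = \sum_i f i (y i)].

Lemma linear_map0 (f : L -> L) : linear f -> f 0 = 0.
Proof.
by move=> h; have := h (-1) 0 0; rewrite scaler0 addr0 scaleN1r addNr.
Qed.

Lemma Adl_subalgebra : Der_subalgebra Adl.
Proof.
have cE (a b : L) : (lbr a \o lbr b) - (lbr b \o lbr a) = lbr (lbr a b).
  by apply/funext => z; rewrite lbr_leibniz.
split.
- move=> _ [a _ <-]; split; first exact: lbr_linearr.
  by move=> x y; rewrite lbr_leibniz subrK.
- split.
    exists 0 => //; apply/funext => y.
    by apply: (linear_map0 (f := lbr^~ y)); exact: lbr_linearl.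
  move=> a _ _ [u _ <-] [v _ <-]; exists (a *: u + v) => //.
  by apply/funext => y; rewrite lbr_linearl.
- by move=> _ _ [a _ <-] [b _ <-]; exists (lbr a b) => //; rewrite cE.
Qed.

Lemma Dcenter_subspace (D : set (L -> L)) : D `<=` Der -> subspace (Dcenter D).
Proof.
move=> DD; split.
  split=> [f /DD[/linear_map0]//|y].
  by apply: (linear_map0 (f := lbr^~ y)); exact: lbr_linearl.
move=> a u v [uA uZ] [vA vZ]; split=> [f Df|y].
  have [lf _] := DD _ Df; rewrite /= lf.
  by rewrite [f u]uA // [f v]vA // scaler0 addr0.
by rewrite lbr_linearl uZ vZ scaler0 addr0.
Qed.

Lemma Dderived_subspace (D : set (L -> L)) :
  Der_subalgebra D -> subspace (Dderived D).
Proof.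
move=> [DD _ _]; split; first by exists 0, (fun=> id), (fun=> 0); split;
  [case|rewrite big_ord0].
move=> a _ _ [n [f [y [Df ->]]]] [m [g [z [Dg ->]]]].
have linZ (h : L -> L) : linear h -> forall b w, h (b *: w) = b *: h w.
  by move=> hl b w; have := hl b w 0; rewrite (linear_map0 hl) !addr0.
pose p (T : Type) (s : 'I_n -> T) (t : 'I_m -> T) (i : 'I_(n + m)) :=
  match fintype.split i with inl j => s j | inr j => t j end.
exists (n + m)%N, (p _ f g), (p _ (fun i => a *: y i) z); split.
  by move=> i; rewrite /p; case: fintype.split.
rewrite big_split_ord scaler_sumr; congr (_ + _); apply: eq_bigr => i _.
  rewrite /p -[lshift m i]/(unsplit (inl i)) unsplitK linZ //.
  by have [] := DD _ (Df i).
by rewrite /p -[rshift n i]/(unsplit (inr i)) unsplitK.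
Qed.

End LeftLeibnizAlgebras.

Arguments Der {F} L.
Arguments Adl {F} L.
Arguments left_center {F} L.

(* Main.v *)
(* Let e_1, ..., e_t represent a basis of L / A_L(D) and d_1, ..., d_k a basis
   of D / Ad^l(L). Every map in D kills A_L(D), and l_a depends only on a modulo
   A_L(D), which lies in the left center. Hence [L,D] is spanned by the t * k
   elements d_i(e_j) and the t * t elements [e_i, e_j]. *)
Require Import Defs.
From mathcomp Require Import all_boot all_order all_algebra.
From mathcomp Require Import boolp classical_sets functions.

Set Implicit Arguments.
Unset Strict Implicit.
Unset Printing Implicit Defensive.

Import GRing.Theory.
Local Open Scope classical_set_scope.
Local Open Scope ring_scope.

Section SpanningFamilies.
Variables (F : fieldType) (V : lmodType F).
Implicit Types (U W P : set V).

Lemma subspaceD W u v : subspace W -> W u -> W v -> W (u + v).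
Proof. by move=> [_ WD] Wu Wv; rewrite -[u]scale1r; apply: WD. Qed.

Lemma subspaceZ W a u : subspace W -> W u -> W (a *: u).
Proof. by move=> [W0 WD] Wu; rewrite -[_ *: _]addr0; apply: WD. Qed.

Lemma subspace_sum W (I : finType) (x : I -> V) :
  subspace W -> (forall i, W (x i)) -> W (\sum_i x i).
Proof.
move=> sW Wx; elim/big_ind: _ => //; first by case: sW.
by move=> u v; apply: subspaceD.
Qed.

Lemma subspace_set0 : subspace ([set 0] : set V).
Proof. by split=> // a u v -> ->; rewrite scaler0 addr0. Qed.

Lemma subspace_preimage (V' : lmodType F) (f : V' -> V) W :
  linear f -> subspace W -> subspace (f @^-1` W).
Proof.
move=> lf [W0 WD]; split=> [|a u v Wu Wv].
  have := lf (-1) 0 0; rewrite scaler0 addr0 scaleN1r addNr.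
  by rewrite /preimage /= => ->.
by rewrite /preimage /= lf; apply: WD.
Qed.

(** Any finite index type is allowed, so that a family indexed by pairs and sums can be used
    directly and counted by its cardinality. *)
Definition lin_span (I : finType) (g : I -> V) : set V :=
  range (fun c : I -> F => \sum_i c i *: g i).

Lemma lin_span_subspace (I : finType) (g : I -> V) : subspace (lin_span g).
Proof.
split=> [|a _ _ [c _ <-] [d _ <-]].
  by exists (fun=> 0) => //; apply: big1 => i _; rewrite scale0r.
exists (fun i => a * c i + d i) => //.
rewrite scaler_sumr -big_split; apply: eq_bigr => i _.
by rewrite scalerDl scalerA.
Qed.

Lemma mem_lin_span (I : finType) (g : I -> V) i : lin_span g (g i).
Proof.
exists (fun j => (j == i)%:R) => //.
rewrite (bigD1 i) //= eqxx scale1r big1 ?addr0 // => j /negPf ->.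
by rewrite scale0r.
Qed.

(** Works as an induction principle: with [P] the preimage of a subspace under a linear map, a claim
    about all of [U] is checked on [W] and on the [e i] alone. *)
Lemma basis_mod_sub U W P n (e : 'I_n -> V) :
  basis_mod U W e -> subspace P -> W `<=` P -> (forall i, P (e i)) -> U `<=` P.
Proof.
move=> [_ _ spanU] sP WP Pe u /spanU[c Wu]; rewrite -(subrK (\sum_i c i *: e i) u).
apply: subspaceD => //; first exact: WP.
by apply: subspace_sum => // i; apply: subspaceZ.
Qed.

Lemma spanning_quot_has_dim U W n (g : 'I_n -> V) :
    subspace W -> (forall i, U (g i)) ->
    (forall u, U u -> exists c : 'I_n -> F, W (u - \sum_i c i *: g i)) ->
  exists m, quot_has_dim U W m /\ (m <= n)%N.
Proof.
move=> sW; elim: n g => [|n IHn] g Ug spanU.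
  by exists 0; split=> //; exists g; split=> // c _ [].
have [free|] := pselect
  (forall c : 'I_n.+1 -> F, W (\sum_i c i *: g i) -> forall i, c i = 0).
  by exists n.+1; split=> //; exists g; split.
move=> /existsNP[c /not_implyP[Wc /existsNP[i /eqP ci0]]].
have [||m [dimU le_mn]] := IHn (g \o lift i).
- by move=> j; apply: Ug.
- move=> u /spanU[b Wb].
  (* Adding [b i / c i] times the relation, which lies in [W], to the old remainder cancels the
     coefficient of [g i]. *)
  exists (fun j => b (lift i j) - b i / c i * c (lift i j)).
  suff -> : u - \sum_j (b (lift i j) - b i / c i * c (lift i j)) *:
      (g \o lift i) j =
    (b i / c i) *: (\sum_j c j *: g j) + (u - \sum_j b j *: g j).
    by case: sW => _; apply.
  rewrite !(bigD1_ord i) //= scalerDr scalerA divfK // scaler_sumr.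
  under eq_bigr do rewrite scalerBl -scalerA.
  rewrite sumrB opprB [RHS]addrCA; congr (u + _).
  by rewrite opprD addrACA subrr add0r.
- by exists m; split=> //; apply: leqW.
Qed.

Lemma lin_span_has_dim (I : finType) (g : I -> V) U :
    (forall i, U (g i)) -> U `<=` lin_span g ->
  exists n, has_dim U n /\ (n <= #|I|)%N.
Proof.
move=> Ug Usub.
apply: (spanning_quot_has_dim (g := g \o enum_val) subspace_set0).
  by move=> i; apply: Ug.
move=> u /Usub[c _ <-]; exists (c \o enum_val) => /=.
by rewrite (reindex _ (onW_bij _ (@enum_val_bij I))) subrr.
Qed.

End SpanningFamilies.

Theorem theoremA (F : fieldType) (L : leibnizType F) (D : set (L -> L))
    (k t : nat) (hD : Der_subalgebra D) (hAd : Adl L `<=` D)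
    (hk : quot_has_dim D (Adl L) k)
    (ht : quot_has_dim [set: L] (Dcenter D) t) :
  exists n : nat, has_dim (Dderived D) n /\ (n <= t * (k + t))%N.
Proof.
case: hk ht => d d_basis [e e_basis]; have [DDer _ _] := hD.
pose g (p : 'I_t * ('I_k + 'I_t)) : L :=
  match p.2 with inl i => d i (e p.1) | inr i => lbr (e i) (e p.1) end.
have image_Dderived f y : D f -> Dderived D (f y).
  move=> Df; exists 1, (fun=> f), (fun=> y); split=> //.
  by rewrite big_ord1.
have sS := lin_span_subspace g.
have S0 : lin_span g 0 by case: sS.
(* With [e j] fixed, the bracket is linear in [a] and vanishes on the left center, so [a] may be
   taken among the [e i]. *)
have span_ad a j : lin_span g (lbr a (e j)).
  have lin_lbr : linear (fun x => lbr x (e j)) by exact: lbr_linearl.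
  apply: (basis_mod_sub e_basis (subspace_preimage lin_lbr sS)) => //.
    by move=> z [_ zZ]; rewrite /preimage /= zZ.
  by move=> i; exact: (mem_lin_span g (j, inr i)).
have span_der f j : D f -> lin_span g (f (e j)).
  (* Now the map varies: evaluation at [e j] is linear in [h], and [span_ad] settles the maps in
     [Adl L]. *)
  have lin_ev : linear (fun h : L -> L => h (e j)) by [].
  apply: (basis_mod_sub d_basis (subspace_preimage lin_ev sS)).
    by move=> _ [a _ <-]; exact: span_ad.
  by move=> i; exact: (mem_lin_span g (j, inl i)).
(* Finally [f] is fixed and [y] varies; here the annihilator half of [Dcenter D] is what makes [f]
   vanish on it. *)
have span_image f y : D f -> lin_span g (f y).
  move=> Df; have [lin_f _] := DDer f Df.
  apply: (basis_mod_sub e_basis (subspace_preimage lin_f sS)) => //.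
    by move=> z [zA _]; rewrite /preimage /= (zA f Df).
  by move=> j; exact: span_der.
have <- : #|{: 'I_t * ('I_k + 'I_t)}| = (t * (k + t))%N.
  by rewrite card_prod card_sum !card_ord.
apply: (lin_span_has_dim (g := g)).
  (* Each generator is the value of a map in [D] at [e j]; for the brackets this map is [lbr (e i)],
     in [D] by [hAd]. *)
  case=> j [i|i]; apply: image_Dderived; first by case: d_basis.
  by apply: hAd; exists (e i).
move=> _ [n [f [y [Df ->]]]].
by apply: subspace_sum => // i; exact: span_image.
Qed.
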